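(* Let $D\in\mathbb{C}^{n\times n}$ be a Hermitian matrix of the form $D=\begin{bmatrix}D_1&0\\ 0&D_2\end{bmatrix}$ with $D_1=\lambda_1 I$, and let $gap=\min_{\lambda\in\Lambda(D_2)}|\lambda_1-\lambda|>0$. Let $$E=\begin{bmatrix}0&E_1\\ E_1^*&0\end{bmatrix},\qquad B=\begin{bmatrix}0&B_1\\ -B_1^*&0\end{bmatrix}$$ be partitioned conformally with $D$, where $B_1$ satisfies $E_1=D_1B_1-B_1D_2$, and assume $\|E_1\|<gap$. For $t\in[0,1]$ let $\lambda_i(t)$ be the $i$-th eigenvalue of $D+tE$, where $i$ is such that $\lambda_i(0)$ is an eigenvalue of $D_1$ (i.e. $\lambda_i(0)=\lambda_1$), and let $x_i(t)$ be a unit-norm eigenvector of $D+tE$ for $\lambda_i(t)$. Define $x_i^{(top)}(t)$ and $r_i(t)$ by $$x_i(t)=\begin{bmatrix}I\\ -tB_2\end{bmatrix}x_i^{(top)}(t)+\begin{bmatrix}0\\ r_i(t)\end{bmatrix},\qquad B_2=-B_1^*,$$ where $x_i^{(top)}(t)$ consists of the first entries of $x_i(t)$ (as many as the size of $D_1$). Then for all $t\in[0,1]$ $$\|r_i(t)\|\le\frac{1}{gap-\|E_1\|}\left(\frac{t^2}{2}\|B_1\|\,\|B_1E_1^*+E_1B_1^*\|+\frac23t^3\,\frac{\|B_1\|^2\|E_1\|^2}{gap-\|E_1\|}\right).$$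
   Context: $\|\cdot\|$ is the spectral norm for matrices and the Euclidean norm for vectors; $\Lambda(\cdot)$ denotes the spectrum. Eigenvalues of the Hermitian matrices $D+tE$ are listed with multiplicity in the same monotone order for all $t$; the symbol $\lambda_1$ denotes the scalar with $D_1=\lambda_1I$ (not necessarily the first eigenvalue in this order). *)

(* Defs.v *)
From mathcomp Require Import all_boot all_order all_algebra.
From mathcomp Require Import complex.
From mathcomp Require Import classical_sets reals.
Set Implicit Arguments.
Unset Strict Implicit.
Unset Printing Implicit Defensive.
Import Order.TTheory GRing.Theory Num.Theory.
Local Open Scope ring_scope.
Local Open Scope complex_scope.
Local Open Scope classical_set_scope.

(* Real-valued modulus: the norm `|z| of R[i] takes its values in R[i]. *)
Definition modulus (R : realType) (z : R[i]) : R := ComplexField.Normc.normc z.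

Definition vnorm (R : realType) (n : nat) (x : 'cV[R[i]]_n) : R :=
  Num.sqrt (\sum_(k < n) modulus (x k 0) ^+ 2).

(* Operator norm induced by the Euclidean norms; the closed unit ball (rather
   than the sphere) keeps the set nonempty when there are no columns. *)
Definition spectral_norm (R : realType) (m n : nat) (A : 'M[R[i]]_(m, n)) : R :=
  sup [set vnorm (A *m x) | x in [set x : 'cV[R[i]]_n | vnorm x <= 1]].

Definition adjoint (R : realType) (m n : nat) (A : 'M[R[i]]_(m, n)) :
  'M[R[i]]_(n, m) := map_mx Num.conj A^T.

Definition is_min (R : realType) (S : set R) (m : R) : Prop :=
  S m /\ lbound S m.

(* [l] lists the (real) eigenvalues of [A] with multiplicity. *)
Definition eigenvalue_list (R : realType) (n : nat) (A : 'M[R[i]]_n)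
    (l : 'I_n -> R) : Prop :=
  char_poly A = \prod_(k < n) ('X - ((l k)%:C)%:P).

Definition unit_eigenvector (R : realType) (n : nat) (A : 'M[R[i]]_n)
    (a : R[i]) (x : 'cV[R[i]]_n) : Prop :=
  vnorm x = 1 /\ A *m x = a *: x.

(* Main.v *)
Require Import Defs.
From mathcomp Require Import all_boot all_order all_algebra.
From mathcomp Require Import complex.
From mathcomp Require Import classical_sets reals.
From mathcomp Require Import perm lra ring.
Import Order.TTheory GRing.Theory Num.Theory.
Local Open Scope ring_scope.
Local Open Scope complex_scope.
Local Open Scope classical_set_scope.

(* Write [x = (u, v)], [M = lambda1 - D2], [w = B1^* u] and
   [delta = lam t - lambda1], so that [E1 = B1 M] and [v = t w + r].
   The two blocks of the eigenvalue equation become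
     [delta u = t E1 (t w + r)]  and  [(M + delta) r = - t delta w].
   Weyl's inequality gives [|delta| <= t |E1| < gap], while [|M r| >= gap |r|];
   hence [<(M + delta) r, M r> >= 0], and pairing the first equation with
   [delta u] gives
     [delta^2 |u|^2 = delta t^2 <w, M w> - <(M + delta) r, M r>],
   so [|delta| |u| <= t^2/2 |B1 E1^* + E1 B1^*| |u|].  The second equation then
   bounds [(gap - |delta|) |r|] by [t |B1| |delta| |u|], which is at most the
   quadratic term of the claim; the cubic term is slack.
   All scalars being real, [< , >] can be taken to be the real part of the
   Hermitian product. *)

Set Implicit Arguments.
Unset Strict Implicit.
Unset Printing Implicit Defensive.

(** * Adjoints, the real inner product and the spectral norm *)

Lemma adjointM (R : realType) m n k (A : 'M[R[i]]_(m, n)) (B : 'M_(n, k)) :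
  adjoint (A *m B) = adjoint B *m adjoint A.
Proof. by rewrite /adjoint trmx_mul map_mxM. Qed.

Lemma adjointK (R : realType) m n (A : 'M[R[i]]_(m, n)) : adjoint (adjoint A) = A.
Proof. by apply/matrixP => j k; rewrite !mxE conjCK. Qed.

Lemma adjointD (R : realType) m n (A B : 'M[R[i]]_(m, n)) :
  adjoint (A + B) = adjoint A + adjoint B.
Proof. by rewrite /adjoint linearD map_mxD. Qed.

Definition rdot (R : realType) n (x y : 'cV[R[i]]_n) : R :=
  complex.Re ((adjoint x *m y) 0 0).

Section RealInnerProduct.
Context (R : realType).
Implicit Types (a b : R) (z : R[i]).

Lemma ReD z1 z2 : complex.Re (z1 + z2) = complex.Re z1 + complex.Re z2.
Proof. by case: z1 z2 => [? ?] []. Qed.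

Lemma Re_sum (I : finType) (F : I -> R[i]) :
  complex.Re (\sum_k F k) = \sum_k complex.Re (F k).
Proof. by apply: (big_morph (fun z : R[i] => complex.Re z) ReD). Qed.

Lemma Re_realM a z : complex.Re (a%:C * z) = a * complex.Re z.
Proof. by case: z => ? ? /=; rewrite mul0r subr0. Qed.

Lemma Re_conj z : complex.Re (Num.conj z) = complex.Re z.
Proof. by case: z. Qed.

Lemma modulus_sqr z : modulus z ^+ 2 = complex.Re (Num.conj z * z).
Proof.
case: z => a b; rewrite /modulus /= sqr_sqrtr ?addr_ge0 ?sqr_ge0 //.
by rewrite mulNr opprK !expr2.
Qed.

Lemma rdotC n (x y : 'cV[R[i]]_n) : rdot x y = rdot y x.
Proof.
rewrite /rdot -Re_conj; congr complex.Re.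
have -> : adjoint y *m x = adjoint (adjoint x *m y) by rewrite adjointM adjointK.
by rewrite !mxE.
Qed.

Lemma rdotDr n (x y z : 'cV[R[i]]_n) : rdot x (y + z) = rdot x y + rdot x z.
Proof. by rewrite /rdot mulmxDr mxE ReD. Qed.

Lemma rdotDl n (x y z : 'cV[R[i]]_n) : rdot (y + z) x = rdot y x + rdot z x.
Proof. by rewrite !(rdotC _ x) rdotDr. Qed.

Lemma rdotZr n a (x y : 'cV[R[i]]_n) : rdot x (a%:C *: y) = a * rdot x y.
Proof. by rewrite /rdot -scalemxAr mxE Re_realM. Qed.

Lemma rdotZl n a (x y : 'cV[R[i]]_n) : rdot (a%:C *: x) y = a * rdot x y.
Proof. by rewrite !(rdotC _ y) rdotZr. Qed.

Lemma rdot_adj m n (A : 'M[R[i]]_(m, n)) x y :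
  rdot (A *m x) y = rdot x (adjoint A *m y).
Proof. by rewrite /rdot adjointM mulmxA. Qed.

Lemma rdotxx n (x : 'cV[R[i]]_n) : rdot x x = vnorm x ^+ 2.
Proof.
rewrite /vnorm sqr_sqrtr ?sumr_ge0 // => [|k _]; last exact: sqr_ge0.
by rewrite /rdot mxE Re_sum; apply: eq_bigr => k _; rewrite modulus_sqr !mxE.
Qed.

Lemma vnorm_ge0 n (x : 'cV[R[i]]_n) : 0 <= vnorm x.
Proof. exact: sqrtr_ge0. Qed.

Lemma modulus_ge0 z : 0 <= modulus z.
Proof. by case: z => a b; apply: sqrtr_ge0. Qed.

Lemma modulus_le_vnorm n (x : 'cV[R[i]]_n) k : modulus (x k 0) <= vnorm x.
Proof.
rewrite -(ler_pXn2r (n := 2)) ?nnegrE ?modulus_ge0 ?vnorm_ge0 //.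
rewrite /vnorm sqr_sqrtr ?sumr_ge0 // => [|j _]; last exact: sqr_ge0.
by rewrite (bigD1 k) //= lerDl sumr_ge0 // => j _; apply: sqr_ge0.
Qed.

Lemma vnorm_eq0 n (x : 'cV[R[i]]_n) : vnorm x = 0 -> x = 0.
Proof.
move=> x0; apply/matrixP => k j; rewrite ord1 mxE.
apply: ComplexField.Normc.eq0_normc.
by apply/eqP; rewrite eq_le modulus_ge0 andbT -x0; apply: modulus_le_vnorm.
Qed.

Lemma vnorm0 n : vnorm (0 : 'cV[R[i]]_n) = 0.
Proof.
apply/eqP; rewrite -sqrf_eq0 -rdotxx.
by rewrite /rdot mulmx0 mxE.
Qed.

Lemma vnormZ n a (x : 'cV[R[i]]_n) : vnorm (a%:C *: x) = `|a| * vnorm x.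
Proof.
apply/eqP; rewrite -(eqrXn2 (n := 2)) ?mulr_ge0 ?vnorm_ge0 //.
by rewrite exprMn -!rdotxx rdotZl rdotZr real_normK ?num_real // mulrA expr2.
Qed.

(** Cauchy-Schwarz. With [c = rdot y y], the squared norm of [c x - (rdot x y) y] expands to
    [c (c (rdot x x) - (rdot x y)^2)], which is therefore nonnegative. *)
Lemma rdot_le n (x y : 'cV[R[i]]_n) : `|rdot x y| <= vnorm x * vnorm y.
Proof.
rewrite -(ler_pXn2r (n := 2)) ?nnegrE ?mulr_ge0 ?vnorm_ge0 //.
rewrite real_normK ?num_real // exprMn -!rdotxx.
have [y0|y_neq0] := eqVneq (vnorm y) 0.
  rewrite [in rdot x y](vnorm_eq0 y0) rdotxx [in X in _ * X]rdotxx y0.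
  by rewrite /rdot mulmx0 mxE /= expr0n /= mulr0.
have c_gt0 : 0 < rdot y y by rewrite rdotxx exprn_gt0 // lt_def y_neq0 vnorm_ge0.
rewrite -(ler_pM2l c_gt0) -subr_ge0.
have := sqr_ge0 (vnorm ((rdot y y)%:C *: x + (- rdot x y)%:C *: y)).
rewrite -rdotxx !rdotDl !rdotDr !rdotZl !rdotZr (rdotC y x).
rewrite le_eqVlt => /orP[/eqP|]; nra.
Qed.

Lemma vnormD n (x y : 'cV[R[i]]_n) : vnorm (x + y) <= vnorm x + vnorm y.
Proof.
rewrite -(ler_pXn2r (n := 2)) ?nnegrE ?addr_ge0 ?vnorm_ge0 //.
rewrite -rdotxx !rdotDl !rdotDr !rdotxx (rdotC y x).
have := rdot_le x y; have := ler_norm (rdot x y); nra.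
Qed.

Lemma modulus_sum_le (I : finType) (F : I -> R[i]) :
  modulus (\sum_k F k) <= \sum_k modulus (F k).
Proof.
elim/big_ind2: _ => [||k _]; rewrite ?lexx //.
  by rewrite /modulus ComplexField.Normc.normc0.
move=> a1 b1 a2 b2 h1 h2; apply: le_trans (lerD h1 h2).
exact: le_normcD.
Qed.

(** [sup] is an upper bound only of a bounded set. Entries of a vector of the unit ball have modulus
    at most 1, so each entry of [A *m x] is bounded by the sum of the moduli along a row of [A]. *)
Lemma unit_ball_image_bounded m n (A : 'M[R[i]]_(m, n)) :
  has_ubound [set vnorm (A *m x) | x in [set x : 'cV[R[i]]_n | vnorm x <= 1]].
Proof.
exists (Num.sqrt (\sum_k (\sum_j modulus (A k j)) ^+ 2)) => _ [x /= x1 <-].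
rewrite ler_sqrt; last by apply: sumr_ge0 => k _; apply: sqr_ge0.
apply: ler_sum => k _.
rewrite ler_pXn2r ?nnegrE ?modulus_ge0 ?sumr_ge0 // => [|j _]; last exact: modulus_ge0.
rewrite mxE; apply: le_trans (modulus_sum_le _) _; apply: ler_sum => j _.
rewrite /modulus ComplexField.Normc.normcM ler_piMr ?modulus_ge0 //.
exact: le_trans (modulus_le_vnorm _ _) x1.
Qed.

Lemma vnorm_mulmx_le m n (A : 'M[R[i]]_(m, n)) x :
  vnorm (A *m x) <= spectral_norm A * vnorm x.
Proof.
have [x0|x_neq0] := eqVneq (vnorm x) 0.
  by rewrite (vnorm_eq0 x0) mulmx0 !vnorm0 mulr0.
have x_gt0 : 0 < vnorm x by rewrite lt_def x_neq0 vnorm_ge0.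
rewrite -ler_pdivrMr // mulrC.
apply: (ub_le_sup (unit_ball_image_bounded A)).
exists ((vnorm x)^-1%:C *: x) => /=.
  by rewrite vnormZ ger0_norm ?invr_ge0 ?vnorm_ge0 // mulVf.
by rewrite -scalemxAr vnormZ ger0_norm // invr_ge0 vnorm_ge0.
Qed.

Lemma spectral_norm_ge0 m n (A : 'M[R[i]]_(m, n)) : 0 <= spectral_norm A.
Proof.
apply: (ub_le_sup (unit_ball_image_bounded A)).
by exists 0; rewrite /= ?mulmx0 vnorm0.
Qed.

(** With [y = A^* x], moving [A] across gives [|y|^2 = <x, A y> <= |x| |A| |y|]; divide by [|y|]. *)
Lemma vnorm_adjoint_le m n (A : 'M[R[i]]_(m, n)) x :
  vnorm (adjoint A *m x) <= spectral_norm A * vnorm x.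
Proof.
set y := adjoint A *m x.
have [y0|y_neq0] := eqVneq (vnorm y) 0.
  by rewrite y0 mulr_ge0 ?spectral_norm_ge0 ?vnorm_ge0.
have y_gt0 : 0 < vnorm y by rewrite lt_def y_neq0 vnorm_ge0.
rewrite -(ler_pM2r y_gt0) -expr2 -rdotxx {1}/y rdot_adj adjointK.
apply: le_trans (ler_norm _) _; apply: le_trans (rdot_le _ _) _.
rewrite -mulrA [leRHS]mulrCA ler_wpM2l ?vnorm_ge0 //.
exact: vnorm_mulmx_le.
Qed.

Lemma vnorm_unitary n (U : 'M[R[i]]_n) x : adjoint U *m U = 1%:M ->
  vnorm (U *m x) = vnorm x.
Proof.
move=> UU; apply/eqP; rewrite -(eqrXn2 (n := 2)) ?vnorm_ge0 //.
by rewrite -!rdotxx rdot_adj mulmxA UU mul1mx.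
Qed.

End RealInnerProduct.

(** * Spectral decomposition of Hermitian matrices *)

Lemma hermsymmx_adjoint (R : realType) n (A : 'M[R[i]]_n) :
  A \is hermsymmx -> adjoint A = A.
Proof. by move=> /is_hermitianmxP; rewrite expr0 scale1r => {2}->. Qed.

Lemma spectral_decomposition (R : realType) n (A : 'M[R[i]]_n) :
  adjoint A = A ->
  exists (U : 'M[R[i]]_n) (d : 'rV[R[i]]_n),
    adjoint U *m U = 1%:M /\ A = U *m diag_mx d *m adjoint U.
Proof.
move=> A_adj.
have /hermitian_normalmx/orthomx_spectralP A_eq : A \is hermsymmx.
  by apply/is_hermitianmxP; rewrite expr0 scale1r -{1}A_adj.
have uni := spectral_unitarymx A.
exists (adjoint (spectralmx A)), (spectral_diag A); rewrite adjointK; split.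
  by apply/unitarymxP.
by rewrite {1}A_eq invmx_unitary.
Qed.

Lemma char_poly_diag_mx (F : comNzRingType) n (d : 'rV[F]_n) :
  char_poly (diag_mx d) = \prod_k ('X - (d 0 k)%:P).
Proof.
rewrite /char_poly.
have -> : char_poly_mx (diag_mx d) = diag_mx (\row_k ('X - (d 0 k)%:P)).
  apply/matrixP => j k; rewrite !mxE.
  by case: eqP => [->|_]; rewrite ?mulr1n ?mulr0n // polyC0 subr0.
by rewrite det_diag; apply: eq_bigr => k _; rewrite mxE.
Qed.

Lemma char_poly_conj (F : comNzRingType) n (U V A : 'M[F]_n) :
  V *m U = 1%:M -> U *m V = 1%:M -> char_poly (U *m A *m V) = char_poly A.
Proof.
move=> VU UV; rewrite /char_poly.
have -> : char_poly_mx (U *m A *m V) =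
    map_mx polyC U *m char_poly_mx A *m map_mx polyC V.
  rewrite /char_poly_mx mulmxBr mulmxBl -!map_mxM /=; congr (_ - _).
  by rewrite scalar_mxC -mulmxA -map_mxM UV map_mx1 mulmx1.
rewrite !det_mulmx mulrC mulrA -det_mulmx -map_mxM VU map_mx1 det1 mul1r //.
Qed.

(** Both [a] and the diagonal of any spectral decomposition list the roots of the same
    characteristic polynomial, so they differ by a permutation; permuting the columns of the unitary
    matrix accordingly puts the eigenvalues in the prescribed order. *)
Lemma spectral_decomposition_list (R : realType) n (A : 'M[R[i]]_n) a :
  adjoint A = A -> eigenvalue_list A a ->
  exists U : 'M[R[i]]_n,
    adjoint U *m U = 1%:M /\
    A = U *m diag_mx (\row_k (a k)%:C) *m adjoint U.
Proof.
move=> /spectral_decomposition[U [d [UU A_eq]]].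
have UU' := mulmx1C UU.
rewrite /eigenvalue_list A_eq char_poly_conj // char_poly_diag_mx => da.
have /tuple_permP [s s_eq] :
    perm_eq [tuple (a k)%:C | k < n] [tuple d 0 k | k < n].
  apply: prod_XsubC_eq; rewrite !big_tuple.
  under eq_bigr do rewrite tnth_mktuple.
  by under [RHS]eq_bigr do rewrite tnth_mktuple.
have {}s_eq k : (a k)%:C = d 0 (s k).
  have := congr1 (fun t => nth 0 t k) s_eq.
  by rewrite -!tnth_nth !tnth_mktuple.
exists (col_perm s U); split.
  have -> : adjoint (col_perm s U) = row_perm s (adjoint U).
    by apply/matrixP => j k; rewrite !mxE.
  by apply/matrixP => j k; move/matrixP: UU => /(_ (s j) (s k));
     rewrite !mxE (inj_eq perm_inj) => <-; apply: eq_bigr => l _; rewrite !mxE.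
apply/matrixP => j k.
rewrite !mxE [RHS](reindex_inj (@perm_inj _ s^-1%g)).
apply: eq_bigr => l _; rewrite !mul_mx_diag !mxE permKV s_eq permKV //.
Qed.

(** In an orthonormal eigenbasis of [A], the matrix [c - A] is diagonal with entries [c - d_k], each
    of modulus at least [g]. *)
Lemma vnorm_sub_lower_bound (R : realType) n (A : 'M[R[i]]_n) (c g : R) x :
  adjoint A = A -> 0 <= g ->
  (forall l, eigenvalue A l -> g <= modulus (c%:C - l)) ->
  g * vnorm x <= vnorm ((c%:C)%:M *m x - A *m x).
Proof.
move=> /spectral_decomposition[U [d [UU A_eq]]] g_ge0 sep.
have UU' := mulmx1C UU.
have UU2 : adjoint (adjoint U) *m adjoint U = 1%:M by rewrite adjointK.
have -> : (c%:C)%:M *m x - A *m x =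
    U *m (diag_mx (\row_k (c%:C - d 0 k)) *m (adjoint U *m x)).
  have -> : diag_mx (\row_k (c%:C - d 0 k)) = (c%:C)%:M - diag_mx d.
    by apply/matrixP => j k; rewrite !mxE mulrnBl.
  rewrite mulmxBl mulmxBr A_eq !mulmxA; congr (_ *m x - _).
  by rewrite scalar_mxC -mulmxA UU' mulmx1.
rewrite vnorm_unitary // -(vnorm_unitary x UU2).
set y := adjoint U *m x.
rewrite -(ler_pXn2r (n := 2)) ?nnegrE ?mulr_ge0 ?vnorm_ge0 // exprMn.
rewrite /vnorm !sqr_sqrtr ?sumr_ge0 // => [|k _|k _]; try exact: sqr_ge0.
rewrite mulr_sumr; apply: ler_sum => k _.
rewrite mul_diag_mx !mxE /modulus ComplexField.Normc.normcM exprMn.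
rewrite ler_wpM2r ?sqr_ge0 // ler_pXn2r ?nnegrE ?modulus_ge0 //.
apply: sep; rewrite eigenvalue_root_char A_eq char_poly_conj // char_poly_diag_mx.
by rewrite (bigD1 k) //= rootM root_XsubC eqxx.
Qed.

(** * Weyl's inequality *)

Lemma rdot_spectral (R : realType) n (A U : 'M[R[i]]_n) a y :
  A = U *m diag_mx (\row_k (a k)%:C) *m adjoint U -> adjoint U *m U = 1%:M ->
  rdot (U *m y) (A *m (U *m y)) = \sum_k a k * modulus (y k 0) ^+ 2.
Proof.
move=> -> UU; rewrite -!mulmxA [adjoint U *m _]mulmxA UU mul1mx.
rewrite rdot_adj mulmxA UU mul1mx /rdot mxE Re_sum; apply: eq_bigr => k _.
by rewrite mul_diag_mx !mxE modulus_sqr mulrCA Re_realM.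
Qed.

(* The matrix [G] has a zero row, and a kernel vector of it has its components
   in the spectral basis of [A] (resp. [H]) supported where [a] (resp. [h]) is
   at least [a i] (resp. at most [h i]). *)
Lemma weyl_upper (R : realType) n (A H : 'M[R[i]]_n) (a h : 'I_n -> R) (e : R) i :
  adjoint A = A -> adjoint H = H ->
  eigenvalue_list A a -> eigenvalue_list H h ->
  (forall k, a i <= a k \/ h k <= h i) ->
  (forall x, rdot x ((A - H) *m x) <= e * vnorm x ^+ 2) ->
  a i <= h i + e.
Proof.
move=> Aadj Hadj Aa Hh cover AH.
have [U [UU A_eq]] := spectral_decomposition_list Aadj Aa.
have [V [VV H_eq]] := spectral_decomposition_list Hadj Hh.
pose W := adjoint V *m U.
pose G := \matrix_(k, j) (if a k < a i then (k == j)%:R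
                          else if h i < h k then W k j else 0).
have : \det G^T == 0.
  rewrite det_tr; apply/eqP; rewrite (expand_det_row _ i) big1 // => j _.
  by rewrite mxE !ltxx mul0r.
move=> /det0P[v v_neq0 vG].
pose y := v^T.
have Gy k : (G *m y) k 0 = 0.
  by have := congr1 (fun M => M^T k 0) vG; rewrite trmx_mul trmxK => ->; rewrite !mxE.
have y_supp k : a k < a i -> y k 0 = 0.
  move=> lt; rewrite -(Gy k) [RHS]mxE (bigD1 k) //= big1 => [|j jk].
    by rewrite addr0 [G _ _]mxE lt eqxx mul1r.
  by rewrite [G _ _]mxE lt eq_sym (negPf jk) mul0r.
pose z := W *m y.
have z_supp k : h i < h k -> z k 0 = 0.
  move=> lt; rewrite -(Gy k) /z ![(_ *m _) k 0]mxE; apply: eq_bigr => j _.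
  (* By [cover], the two strict inequalities cannot hold for the same [k], so row [k] of [G] is row
     [k] of [W]. *)
  rewrite [G _ _]mxE lt ifF //; apply/negP => lt'.
  by case: (cover k); rewrite leNgt ?lt ?lt'.
pose x := U *m y.
have xz : x = V *m z by rewrite /z /W mulmxA mulmxA (mulmx1C VV) mul1mx.
have x_y : vnorm x = vnorm y by rewrite vnorm_unitary.
have x_z : vnorm x = vnorm z by rewrite xz vnorm_unitary.
have vnormE m (u : 'cV[R[i]]_m) : vnorm u ^+ 2 = \sum_k modulus (u k 0) ^+ 2.
  by rewrite sqr_sqrtr ?sumr_ge0 // => k _; apply: sqr_ge0.
have m0 : modulus (0 : R[i]) = 0 by apply: ComplexField.Normc.normc0.
(* The supports of [y] and [z] bound the quadratic form of [A] at [x] from below and that of [H]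
   from above; [A - H] accounts for the difference. *)
have lo : a i * vnorm x ^+ 2 <= rdot x (A *m x).
  rewrite (rdot_spectral _ A_eq UU) x_y vnormE mulr_sumr; apply: ler_sum => k _.
  have [/y_supp ->|le] := ltP (a k) (a i); first by rewrite m0 expr0n !mulr0.
  by rewrite ler_wpM2r ?sqr_ge0.
have hi : rdot x (H *m x) <= h i * vnorm x ^+ 2.
  rewrite x_z vnormE xz (rdot_spectral _ H_eq VV) mulr_sumr; apply: ler_sum => k _.
  have [/z_supp ->|le] := ltP (h i) (h k); first by rewrite m0 expr0n !mulr0.
  by rewrite ler_wpM2r ?sqr_ge0.
have x_gt0 : 0 < vnorm x ^+ 2.
  rewrite exprn_gt0 // lt_def vnorm_ge0 andbT x_y; apply: contra v_neq0 => /eqP.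
  by move=> /vnorm_eq0 y0; rewrite -[v]trmxK -/y y0 trmx0.
rewrite -(ler_pM2r x_gt0) mulrDl.
have AE : A *m x = H *m x + (A - H) *m x by rewrite -mulmxDl addrC subrK.
have := AH x; move: lo; rewrite AE rdotDr; lra.
Qed.

(** * Block matrices and quadratic forms of the perturbation *)

Lemma adjoint_realZ (R : realType) m n (a : R) (A : 'M[R[i]]_(m, n)) :
  adjoint (a%:C *: A) = a%:C *: adjoint A.
Proof.
apply/matrixP => j k; rewrite !mxE rmorphM /=; congr (_ * _).
exact: conjc_real.
Qed.

Lemma adjoint_block (R : realType) m1 m2 n1 n2 (A : 'M[R[i]]_(m1, n1))
    (B : 'M_(m1, n2)) (C : 'M_(m2, n1)) (D : 'M_(m2, n2)) :
  adjoint (block_mx A B C D) =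
  block_mx (adjoint A) (adjoint C) (adjoint B) (adjoint D).
Proof. by rewrite /adjoint tr_block_mx map_block_mx. Qed.

Lemma rdot_col_mx (R : realType) p q (u u' : 'cV[R[i]]_p) (v v' : 'cV_q) :
  rdot (col_mx u v) (col_mx u' v') = rdot u u' + rdot v v'.
Proof. by rewrite /rdot /adjoint tr_col_mx map_row_mx mul_row_col mxE ReD. Qed.

(** For [x = (u, v)] the form of the off-diagonal matrix is [2 Re <u, E1 v>], and
    [2 |u| |v| <= |u|^2 + |v|^2 = |x|^2]. This is the input to Weyl's inequality. *)
Lemma rdot_offdiag_le (R : realType) p q (E1 : 'M[R[i]]_(p, q)) (s : R) x :
  rdot x (s%:C *: block_mx 0 E1 (adjoint E1) 0 *m x) <=
  `|s| * spectral_norm E1 * vnorm x ^+ 2.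
Proof.
rewrite -[x]vsubmxK; set u := usubmx x; set v := dsubmx x.
rewrite -scalemxAl rdotZr mul_block_col !mul0mx add0r addr0 rdot_col_mx.
rewrite -rdotxx rdot_col_mx !rdotxx (rdotC v) rdot_adj adjointK.
apply: le_trans (ler_norm _) _; rewrite normrM -mulrA ler_wpM2l //.
apply: (@le_trans _ _ (2 * (vnorm u * (spectral_norm E1 * vnorm v)))).
  apply: le_trans (ler_normD _ _) _; rewrite -mulr2n mulr_natl lerMn2r /=.
  apply: le_trans (rdot_le _ _) _.
  by rewrite ler_wpM2l ?vnorm_ge0 ?vnorm_mulmx_le.
have := sqr_ge0 (vnorm u - vnorm v); have := spectral_norm_ge0 E1; nra.
Qed.

(** Symmetrizing the product turns twice its real part into the quadratic form of [B A^* + A B^*] at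
    [u]. This is the origin of both the symmetrized norm and the factor 1/2 in the final bound. *)
Lemma rdot_adjoint_le (R : realType) p q (A B : 'M[R[i]]_(p, q)) u :
  2 * `|rdot (adjoint A *m u) (adjoint B *m u)| <=
  spectral_norm (B *m adjoint A + A *m adjoint B) * vnorm u ^+ 2.
Proof.
have eq2 : 2 * rdot (adjoint A *m u) (adjoint B *m u) =
    rdot u ((B *m adjoint A + A *m adjoint B) *m u).
  rewrite mulmxDl rdotDr -!mulmxA.
  have adj_l (C : 'M[R[i]]_(p, q)) y : rdot u (C *m y) = rdot (adjoint C *m u) y.
    by rewrite rdot_adj adjointK.
  by rewrite !adj_l (rdotC (adjoint B *m u)) mulr_natl mulr2n.
have -> : 2 * `|rdot (adjoint A *m u) (adjoint B *m u)| =
    `|rdot u ((B *m adjoint A + A *m adjoint B) *m u)|.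
  by rewrite -eq2 normrM ger0_norm.
apply: le_trans (rdot_le _ _) _.
by rewrite expr2 mulrCA ler_wpM2l ?vnorm_ge0 ?vnorm_mulmx_le.
Qed.

(** * The eigenvalue shift and the residual *)

(** Weyl's inequality only gives a shift of order [t]. Substituting the second equation into the
    first exposes the order [t^2], because the remaining term in [r] has a favourable sign. *)
Lemma eigenvalue_shift_le (R : realType) p q (M : 'M[R[i]]_q)
    (B1 : 'M[R[i]]_(p, q)) (u : 'cV_p) (r : 'cV_q) (delta t g : R) :
  adjoint M = M -> (forall y, g * vnorm y <= vnorm (M *m y)) ->
  `|delta| <= g ->
  delta%:C *: u = t%:C *: (B1 *m M *m (t%:C *: (adjoint B1 *m u) + r)) ->
  M *m r + delta%:C *: r = (- (t * delta))%:C *: (adjoint B1 *m u) ->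
  `|delta| * vnorm u <=
  t ^+ 2 / 2 * spectral_norm (B1 *m adjoint (B1 *m M) + (B1 *m M) *m adjoint B1)
    * vnorm u.
Proof.
move=> Madj Mg dg eq_u eq_r.
set S := spectral_norm _; set w := adjoint B1 *m u in eq_u eq_r *.
have [u0|u_neq0] := eqVneq (vnorm u) 0; first by rewrite u0 !mulr0.
have u_gt0 : 0 < vnorm u by rewrite lt_def u_neq0 vnorm_ge0.
have S_ge0 : 0 <= S := spectral_norm_ge0 _.
have [d0|d_neq0] := eqVneq delta 0.
  rewrite d0 normr0 mul0r mulr_ge0 ?vnorm_ge0 //.
  by rewrite mulr_ge0 // divr_ge0 // sqr_ge0.
have d_gt0 : 0 < `|delta| by rewrite normr_gt0.
have adjE : adjoint (B1 *m M) *m u = M *m w by rewrite adjointM Madj mulmxA.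
have main : delta * vnorm u ^+ 2 =
    t * (t * rdot (M *m w) w + rdot w (M *m r)).
  rewrite -rdotxx -[in LHS]rdotZr eq_u rdotZr -{1}[B1 *m M]adjointK.
  by rewrite -rdot_adj adjE rdotDr rdotZr (rdot_adj M w r) Madj.
(* By [eq_r] this term is [-(|M r|^2 + delta <r, M r>)], and [|delta| |r| <= g |r| <= |M r|] makes
   the square dominate. *)
have cross : delta * (t * rdot w (M *m r)) <= 0.
  have -> : delta * (t * rdot w (M *m r)) = - rdot (M *m r + delta%:C *: r) (M *m r).
    by rewrite eq_r rdotZl; ring.
  rewrite oppr_le0 rdotDl rdotZl rdotxx.
  have h1 := rdot_le r (M *m r); have h2 := Mg r.
  have h3 : `|delta * rdot r (M *m r)| <= vnorm (M *m r) * vnorm (M *m r).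
    rewrite normrM; apply: le_trans (ler_wpM2l (normr_ge0 _) h1) _.
    rewrite mulrA ler_wpM2r ?vnorm_ge0 //; apply: le_trans h2.
    by rewrite ler_wpM2r ?vnorm_ge0.
  by move: h3; rewrite ler_norml expr2 => /andP[]; lra.
have := rdot_adjoint_le (B1 *m M) B1 u; rewrite adjE -/S -/w => S_u.
(* Multiplying by [|delta| |u|] turns the left side into [delta^2 |u|^2], so that [main] and the
   sign of [cross] apply whatever the sign of [delta]. *)
rewrite -(ler_pM2l d_gt0) -(ler_pM2r u_gt0).
have -> : `|delta| * (`|delta| * vnorm u) * vnorm u = delta * (delta * vnorm u ^+ 2).
  by rewrite mulrA -expr2 real_normK ?num_real //; ring.
rewrite main.
have -> : delta * (t * (t * rdot (M *m w) w + rdot w (M *m r))) =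
  t ^+ 2 * (delta * rdot (M *m w) w) + delta * (t * rdot w (M *m r)) by ring.
apply: le_trans (_ : t ^+ 2 * (`|delta| * `|rdot (M *m w) w|) <= _).
  rewrite -[leRHS]addr0 lerD // ler_wpM2l ?sqr_ge0 // -normrM ler_norm //.
have -> : `|delta| * (t ^+ 2 / 2 * S * vnorm u) * vnorm u =
  t ^+ 2 * (`|delta| * (S * vnorm u ^+ 2 / 2)) by field.
by rewrite ler_wpM2l ?sqr_ge0 // ler_wpM2l // ler_pdivlMr // mulrC.
Qed.

(** Here [d] is the shift, [e], [b], [S] are the norms of [E1], [B1] and the symmetrized product,
    and [nu], [nw], [nr] those of [u], [w], [r]. The chain is [(g - e) nr <= (g - |d|) nr <= t |d|
    nw <= t b |d| nu <= t b (t^2/2) S]. *)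
Lemma residual_arith (R : realFieldType) (t d g e b S nu nw nr : R) :
  0 <= t <= 1 -> 0 <= e -> e < g -> 0 <= b -> 0 <= S -> 0 <= nr ->
  `|d| <= t * e -> nu <= 1 -> nw <= b * nu ->
  `|d| * nu <= t ^+ 2 / 2 * S * nu ->
  (g - `|d|) * nr <= t * `|d| * nw ->
  nr <= 1 / (g - e) * (t ^+ 2 / 2 * b * S +
    2 / 3 * t ^+ 3 * (b ^+ 2 * e ^+ 2 / (g - e))).
Proof.
move=> /andP[t_ge0 t_le1] e_ge0 eg b_ge0 S_ge0 nr_ge0 d_le nu_le1 nw_le d_nu r_le.
have ge_gt0 : 0 < g - e by rewrite subr_gt0.
have t22_ge0 : 0 <= t ^+ 2 / 2 by rewrite divr_ge0 // sqr_ge0.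
have d_e : `|d| <= e by apply: le_trans d_le _; rewrite ler_piMl.
rewrite mul1r mulrC ler_pdivlMr //.
apply: (@le_trans _ _ (t ^+ 2 / 2 * b * S)); last first.
  have rest_ge0 : 0 <= b ^+ 2 * e ^+ 2 / (g - e).
    by rewrite divr_ge0 ?mulr_ge0 ?sqr_ge0 // ltW.
  by rewrite lerDl mulr_ge0 // mulr_ge0 ?exprn_ge0 // divr_ge0.
apply: (@le_trans _ _ ((g - `|d|) * nr)).
  by rewrite mulrC ler_wpM2r // lerB.
apply: (le_trans r_le); apply: (@le_trans _ _ (t * `|d| * (b * nu))).
  by rewrite ler_wpM2l // mulr_ge0.
have -> : t * `|d| * (b * nu) = t * b * (`|d| * nu) by ring.
apply: (@le_trans _ _ (t * b * (t ^+ 2 / 2 * S))).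
  rewrite ler_wpM2l ?mulr_ge0 //; apply: (le_trans d_nu).
  by rewrite ler_piMr // mulr_ge0.
(* The chain ends with [t^3/2]; [t <= 1] lowers the power to that of the claim. *)
have -> : t * b * (t ^+ 2 / 2 * S) = t * (t ^+ 2 / 2 * b * S) by ring.
by rewrite ler_piMl // mulr_ge0 // mulr_ge0.
Qed.

(** * Derivation of the block equations and of the final bound *)

Unset Implicit Arguments.
Set Strict Implicit.

Theorem theorem6p3 (R : realType) (p q : nat)
    (D E B : 'M[R[i]]_(p + q))
    (D1 : 'M[R[i]]_p) (D2 : 'M[R[i]]_q)
    (E1 B1 : 'M[R[i]]_(p, q)) (B2 : 'M[R[i]]_(q, p))
    (lambda1 : R[i]) (gap : R)
    (D_herm : D \is hermsymmx)
    (D_def : D = block_mx D1 0 0 D2)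
    (D1_def : D1 = lambda1%:M)
    (gap_def : is_min [set modulus (lambda1 - l) | l in [set l | eigenvalue D2 l]] gap)
    (gap_gt0 : 0 < gap)
    (E_def : E = block_mx 0 E1 (adjoint E1) 0)
    (B_def : B = block_mx 0 B1 (- adjoint B1) 0)
    (B2_def : B2 = - adjoint B1)
    (E1_B1 : E1 = D1 *m B1 - B1 *m D2)
    (E1_lt_gap : spectral_norm E1 < gap)
    (lam : R -> 'I_(p + q) -> R)
    (lam_eig : forall t : R, 0 <= t <= 1 ->
       eigenvalue_list (D + t%:C *: E) (lam t))
    (lam_mono :
       (forall t : R, 0 <= t <= 1 ->
          forall j k : 'I_(p + q), (j <= k)%N -> lam t j <= lam t k) \/
       (forall t : R, 0 <= t <= 1 ->
          forall j k : 'I_(p + q), (j <= k)%N -> lam t k <= lam t j))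
    (i : 'I_(p + q)) (lam_i0 : (lam 0 i)%:C = lambda1)
    (x : R -> 'cV[R[i]]_(p + q))
    (x_eig : forall t : R, 0 <= t <= 1 ->
       unit_eigenvector (D + t%:C *: E) (lam t i)%:C (x t))
    (xtop : R -> 'cV[R[i]]_p)
    (xtop_def : forall t : R, 0 <= t <= 1 -> xtop t = usubmx (x t))
    (r : R -> 'cV[R[i]]_q)
    (r_def : forall t : R, 0 <= t <= 1 ->
       x t = col_mx 1%:M (- (t%:C *: B2)) *m xtop t + col_mx 0 (r t)) :
  forall t : R, 0 <= t <= 1 ->
    vnorm (r t) <=
      1 / (gap - spectral_norm E1) *
        (t ^+ 2 / 2 * spectral_norm B1 *
           spectral_norm (B1 *m adjoint E1 + E1 *m adjoint B1) +
         2 / 3 * t ^+ 3 *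
           (spectral_norm B1 ^+ 2 * spectral_norm E1 ^+ 2 /
              (gap - spectral_norm E1))).
Proof.
move=> t t01; have /andP[t_ge0 t_le1] := t01.
set l1 := lam 0 i in lam_i0; set delta := lam t i - l1.
set e := spectral_norm E1 in E1_lt_gap *.
have e_ge0 : 0 <= e := spectral_norm_ge0 E1.
have D_adj := hermsymmx_adjoint D_herm.
have D2_adj : adjoint D2 = D2.
  have := congr1 drsubmx D_adj.
  by rewrite D_def adjoint_block !block_mxKdr.
have E_adj : adjoint E = E.
  have adj0 m n : adjoint (0 : 'M[R[i]]_(m, n)) = 0.
    by rewrite /adjoint trmx0 map_mx0.
  by rewrite E_def adjoint_block adjointK !adj0.
have E_le s y : rdot y (s%:C *: E *m y) <= `|s| * e * vnorm y ^+ 2.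
  by rewrite E_def; apply: rdot_offdiag_le.
have zero01 : 0 <= (0 : R) <= 1 by rewrite lexx ler01.
have lam0_eig : eigenvalue_list D (lam 0).
  by have := lam_eig 0 zero01; rewrite scale0r addr0.
have At_adj : adjoint (D + t%:C *: E) = D + t%:C *: E.
  by rewrite adjointD adjoint_realZ D_adj E_adj.
have delta_le : `|delta| <= t * e.
  have weyl_up : lam t i <= l1 + t * e.
    apply: (weyl_upper At_adj D_adj (lam_eig t t01) lam0_eig) => [k|y].
      (* Both lists are sorted in the same direction, so comparing the indices [i] and [k] decides
         which alternative holds. *)
      case: lam_mono => mono; case/orP: (leq_total i k) => ik;
        by [left; apply: mono | right; apply: mono].
    by rewrite addrC addKr -[leRHS]/(t * e * _) -{2}(ger0_norm t_ge0).
  have weyl_low : l1 <= lam t i + t * e.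
    apply: (weyl_upper D_adj At_adj lam0_eig (lam_eig t t01)) => [k|y].
      case: lam_mono => mono; case/orP: (leq_total i k) => ik;
        by [left; apply: mono | right; apply: mono].
    rewrite opprD addNKr -scaleNr -rmorphN -{2}(ger0_norm t_ge0) -normrN.
    exact: E_le.
  by rewrite ler_norml /delta; apply/andP; split; lra.
have gap_min l : eigenvalue D2 l -> gap <= modulus (l1%:C - l).
  by move=> Dl; apply: gap_def.2; exists l => //; rewrite -lam_i0.
(* Since [lambda1] is the image of the real number [l1], this matrix is Hermitian; since [D1] is
   scalar, the Sylvester equation factors as [E1 = B1 M]. *)
pose M : 'M[R[i]]_q := (l1%:C)%:M - D2.
have M_adj : adjoint M = M.
  have -> : adjoint M = adjoint (l1%:C)%:M - adjoint D2.
    by apply/matrixP => j k; rewrite !mxE rmorphB.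
  rewrite D2_adj /adjoint tr_scalar_mx map_scalar_mx.
  by congr (_%:M - _); apply: conjc_real.
have Mg y : gap * vnorm y <= vnorm (M *m y).
  by rewrite mulmxBl; apply: vnorm_sub_lower_bound => //; apply: ltW.
have E1M : E1 = B1 *m M.
  by rewrite E1_B1 D1_def -lam_i0 mulmxBr scalar_mxC.
pose u := xtop t; pose w := adjoint B1 *m u.
have x_blocks : x t = col_mx u (t%:C *: w + r t).
  rewrite (r_def t t01) mul_col_mx mul1mx add_col_mx addr0 B2_def.
  by rewrite scalerN opprK -scalemxAl.
have [x1 x_eq] := x_eig t t01.
have u_le1 : vnorm u <= 1.
  rewrite -(ler_pXn2r (n := 2)) ?nnegrE ?vnorm_ge0 // -[1 in leRHS]x1 -!rdotxx.
  by rewrite x_blocks rdot_col_mx lerDl rdotxx sqr_ge0.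
have lam_t : (lam t i)%:C = l1%:C + delta%:C :> R[i].
  by rewrite -rmorphD /= addrC subrK.
move: x_eq; rewrite x_blocks D_def E_def scale_block_mx add_block_mx !scaler0.
rewrite !add0r !addr0 mul_block_col scale_col_mx => /eq_col_mx[eq_top eq_bot].
have eq_u : delta%:C *: u = t%:C *: (B1 *m M *m (t%:C *: w + r t)).
  apply: (addrI (l1%:C *: u)); rewrite -scalerDl -lam_t -eq_top.
  by rewrite D1_def -lam_i0 mul_scalar_mx -scalemxAl E1M.
(* Writing [D2 = l1 - M] in the lower block, [t E1^* u = t M w] cancels [M (t w)]: the first-order
   part [t w] was chosen for this. *)
have eq_r : M *m r t + delta%:C *: r t = (- (t * delta))%:C *: w.
  have D2E y : D2 *m y = l1%:C *: y - M *m y.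
    by rewrite mulmxBl mul_scalar_mx opprB addrC subrK.
  move: eq_bot; rewrite lam_t E1M adjointM M_adj D2E -scalemxAl -mulmxA.
  rewrite mulmxDr -scalemxAr scalerDl addrCA => /addrI.
  rewrite opprD addNKr scalerDr => /(congr1 -%R); rewrite opprK => ->.
  by rewrite opprD subrK scalerA -scaleNr rmorphN /= mulrC rmorphM.
have delta_gap : `|delta| <= gap.
  by apply: le_trans delta_le _; apply: le_trans (ltW E1_lt_gap); rewrite ler_piMl.
have := eigenvalue_shift_le M_adj Mg delta_gap eq_u eq_r.
rewrite -E1M; set S := spectral_norm (_ + _) => shift.
have w_le : vnorm w <= spectral_norm B1 * vnorm u := vnorm_adjoint_le B1 u.
have S_ge0 : 0 <= S := spectral_norm_ge0 _.
have b_ge0 : 0 <= spectral_norm B1 := spectral_norm_ge0 _.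
set b := spectral_norm B1 in w_le b_ge0 *.
apply: (residual_arith t01 e_ge0 E1_lt_gap b_ge0 S_ge0 _ delta_le u_le1 w_le shift).
  exact: vnorm_ge0.
(* Triangle inequality for [M r = (M + delta) r - delta r], which gives
   [(gap - |delta|) |r| <= t |delta| |w|]. *)
have := vnormD (M *m r t + delta%:C *: r t) ((- delta)%:C *: r t).
rewrite -addrA -scalerDl -rmorphD subrr scale0r addr0 eq_r !vnormZ.
rewrite !normrN normrM (ger0_norm t_ge0).
by have := Mg (r t); lra.
Qed.
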